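(* Let $(X,f_{1,\infty})$ be a non-autonomous discrete dynamical system where each $f_n$ is surjective and $f_m\circ f_n=f_n\circ f_m$ for all $m,n\in\mathbb{N}$. If $(X,f_{1,\infty})$ is locally eventually onto, then $(X,g_{1,\infty})$ is locally eventually onto for every rearrangement $g_{1,\infty}$ of $f_{1,\infty}$.
   Context: $\mathbb{N}=\{1,2,3,\dots\}$. A non-autonomous discrete dynamical system (NDDS) is a pair $(X,f_{1,\infty})$ where $X$ is a compact metric space and $f_{1,\infty}=(f_n)_{n\in\mathbb{N}}$ is a sequence of continuous maps $f_n:X\to X$; $f_1^n:=f_n\circ\cdots\circ f_1$. The system is locally eventually onto if for every nonempty open $V\subset X$ there exists $k\in\mathbb{N}$ such that $f_1^k(V)=X$. A rearrangement of $f_{1,\infty}$ is a sequence $g_{1,\infty}=(g_n)_{n\in\mathbb{N}}$ with $g_n=f_{\sigma(n)}$ for all $n$, for some bijection $\sigma:\mathbb{N}\to\mathbb{N}$. *)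

(* Defs.v *)
From mathcomp Require Import all_boot all_order all_algebra.
From mathcomp Require Import all_classical all_reals all_analysis.

Set Implicit Arguments.
Unset Strict Implicit.
Unset Printing Implicit Defensive.

Local Open Scope classical_set_scope.

(* Sequences indexed by {1, 2, 3, ...} are shifted to [nat]: [f n] stands for
   the map written f_(n+1) on paper. *)

Definition ndds (R : realType) (X : metricType R) (f : nat -> X -> X) : Prop :=
  compact [set: X] /\ forall n, continuous (f n).

(* f_1^n, i.e. [f n.-1 \o ... \o f 0] (the identity for n = 0). *)
Fixpoint fcomp (X : Type) (f : nat -> X -> X) (n : nat) : X -> X :=
  if n is n'.+1 then f n' \o fcomp f n' else id.

Definition locally_eventually_onto (X : topologicalType) (f : nat -> X -> X)
    : Prop :=
  forall V : set X, open V -> V !=set0 ->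
    exists2 k : nat, (0 < k)%N & fcomp f k @` V = [set: X].

Definition rearrangement (X : Type) (f g : nat -> X -> X) : Prop :=
  exists2 sigma : nat -> nat, bijective sigma & forall n, g n = f (sigma n).

(* Main.v *)
Require Import Defs.
From mathcomp Require Import all_boot all_order all_algebra.
From mathcomp Require Import all_classical all_reals all_analysis.

Local Open Scope classical_set_scope.

(** Suppose [f_1^k(V) = X]. For [K] large, the indices of [g_1^K] include those
of [f_1^k]; since the maps commute, [g_1^K = h \o f_1^k] where [h] is a
composition of surjective maps, hence [g_1^K(V) = h(X) = X]. *)

(** Compositions along arbitrary lists, unlike [fcomp], allow a single index to be deleted
    anywhere. *)
Definition seqcomp {T : Type} (f : nat -> T -> T) (s : seq nat) : T -> T :=
  foldr (fun i h => f i \o h) id s.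

(** The head of the list is the outermost map in [seqcomp], whereas [fcomp] applies index 0 first;
    hence [rev]. *)
Lemma fcomp_reindex {T : Type} (f : nat -> T -> T) (sigma : nat -> nat) n :
  fcomp (fun i => f (sigma i)) n = seqcomp f (rev (map sigma (iota 0 n))).
Proof.
elim: n => [//|n IHn].
by rewrite -addn1 iotaD map_cat rev_cat addn1 /= IHn.
Qed.

Lemma seqcomp_surj {T : Type} (f : nat -> T -> T) (s : seq nat) :
  (forall n, set_surj [set: T] [set: T] (f n)) ->
  seqcomp f s @` [set: T] = [set: T].
Proof.
move=> f_surj; elim: s => [|i s IHs] /=; first exact: image_id.
by rewrite -image_comp IHs; apply/seteqP; split=> // x /f_surj.
Qed.

Section Commuting.
Context {T : Type} (f : nat -> T -> T).
Hypothesis f_comm : forall m n, f m \o f n = f n \o f m.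

Lemma fcomp_comm i k : fcomp f k \o f i = f i \o fcomp f k.
Proof.
elim: k => [//|k IHk] /=.
by rewrite -compA IHk compA f_comm.
Qed.

Lemma seqcomp_comm i s : seqcomp f s \o f i = f i \o seqcomp f s.
Proof.
elim: s => [//|j s IHs] /=.
by rewrite -compA IHs compA f_comm.
Qed.

(** The first occurrence of [f i] is moved by commutation to the innermost place. *)
Lemma seqcomp_rem i s : i \in s -> seqcomp f s = seqcomp f (rem i s) \o f i.
Proof.
elim: s => [//|j s IHs]; rewrite inE /=.
by have [->|_ /= /IHs ->] := eqVneq j i; first by rewrite seqcomp_comm.
Qed.

(** Induction on [k]: extract [f k], then factor what remains. Deleting one [k] from [s] keeps every
    index below [k]. *)
Lemma seqcomp_factor k s : (forall i, (i < k)%N -> i \in s) ->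
  exists s', seqcomp f s = seqcomp f s' \o fcomp f k.
Proof.
elim: k s => [|k IHk] s s_sub; first by exists s.
have [i lt_ik|s' s'E] := IHk (rem k s).
  have := s_sub i (ltnW lt_ik).
  by rewrite (perm_mem (perm_to_rem (s_sub k (ltnSn k)))) inE ltn_eqF.
by exists s'; rewrite (seqcomp_rem _ _ (s_sub k (ltnSn k))) s'E -compA fcomp_comm.
Qed.

End Commuting.

Theorem proposition3p5 (R : realType) (X : metricType R) (f : nat -> X -> X)
    (f_ndds : ndds f)
    (f_surj : forall n : nat, set_surj [set: X] [set: X] (f n))
    (f_comm : forall m n : nat, f m \o f n = f n \o f m)
    (f_leo : locally_eventually_onto f) :
  forall g : nat -> X -> X, rearrangement f g -> locally_eventually_onto g.
Proof.
move=> g [sigma [tau _ sigmaK] /funext ->] V Vo V0.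
have [k _ fkV] := f_leo V Vo V0.
(* [K] exceeds [tau i] for every [i < k], so each such [i = sigma (tau i)] occurs among the first
   [K] values of [sigma]; the successor also makes [K] positive. *)
pose K := (\max_(i < k) tau i).+1.
exists K => //; rewrite fcomp_reindex.
have [i lt_ik|s' ->] := @seqcomp_factor X f f_comm k (rev (map sigma (iota 0 K))).
  rewrite mem_rev -(sigmaK i) map_f // mem_iota /= add0n ltnS.
  exact: (leq_bigmax (F := fun j : 'I_k => tau j) (Ordinal lt_ik)).
by rewrite -image_comp fkV seqcomp_surj.
Qed.
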